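(* Let $\alpha$ be a Salem number of degree $d$ and let $\eta=\frac1L(l_0+l_1\alpha+\dots+l_{d-1}\alpha^{d-1})\in\mathbb{Q}(\alpha)\setminus\{0\}$ with $L\ge1$ an integer, $l_0,\dots,l_{d-1}\in\mathbb{Z}$, and $\gcd(l_0,\dots,l_{d-1},L)=1$. Let $\sigma_0:\mathbb{Q}(\alpha)\hookrightarrow\mathbb{C}$ be the embedding with $\sigma_0(\alpha)=\alpha^{-1}$. For $0<\delta<1/2$ put $J(\delta)=[\delta,1-\delta]$. Then there exists $\delta=\delta(L,|\eta|,|\sigma_0(\eta)|)\in(0,1/2)$, depending (for the given $\alpha$) only on $L$, $|\eta|$ and $|\sigma_0(\eta)|$, such that the following limit exists and satisfies $$\lim_{N\to\infty}\frac{\#\{0\le n\le N:\ \{\eta\alpha^n\}\in J(\delta)\}}{N}\ \ge\ \frac12 .$$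
   Context: Salem number: a real algebraic integer $\alpha>1$ all of whose other Galois conjugates lie in the closed unit disk, with at least one on the unit circle (then $\alpha^{-1}$ is a conjugate of $\alpha$). $\{x\}=x-\lfloor x\rfloor$ denotes the fractional part of a real number $x$. *)

(* Defs.v *)
From HB Require Import structures.
From mathcomp Require Import all_boot all_order all_algebra.
From mathcomp Require Import complex.
From mathcomp Require Import all_classical all_reals all_analysis.

Set Implicit Arguments.
Unset Strict Implicit.
Unset Printing Implicit Defensive.

Import Order.TTheory GRing.Theory Num.Theory.
Import numFieldNormedType.Exports.

Local Open Scope ring_scope.

Section AdjoinRational.
Variables (R : realType) (a : R).

(* Q(a) as the intersection of all subfields of R containing a. *)
Definition in_Qadjoin : {pred R} :=
  fun x => `[< forall S : divringClosed R, a \in S -> x \in S >].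

Fact in_Qadjoin_divring : divring_closed in_Qadjoin.
Proof.
split.
- by apply/asboolP => S _; exact: rpred1.
- move=> x y /asboolP Sx /asboolP Sy; apply/asboolP => S Sa.
  by rewrite rpredB ?Sx ?Sy.
- move=> x y /asboolP Sx /asboolP Sy; apply/asboolP => S Sa.
  by rewrite rpred_div ?Sx ?Sy.
Qed.

HB.instance Definition _ :=
  GRing.isDivringClosed.Build R in_Qadjoin in_Qadjoin_divring.

Record Qadjoin := MkQadjoin { Qadjoin_val :> R; _ : Qadjoin_val \in in_Qadjoin }.

HB.instance Definition _ := [isSub for Qadjoin_val].
HB.instance Definition _ := [Choice of Qadjoin by <:].
HB.instance Definition _ := [SubChoice_isSubIntegralDomain of Qadjoin by <:].
HB.instance Definition _ := [SubIntegralDomain_isSubField of Qadjoin by <:].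

Fact gen_in_Qadjoin : a \in in_Qadjoin.
Proof. by apply/asboolP. Qed.

Definition Qgen : Qadjoin := MkQadjoin gen_in_Qadjoin.

End AdjoinRational.

Definition is_minpoly (R : realType) (a : R) (p : {poly rat}) : Prop :=
  [/\ p \is monic, irreducible_poly p & root (map_poly ratr p) a].

Definition has_degree (R : realType) (a : R) (d : nat) : Prop :=
  exists2 p : {poly rat}, is_minpoly a p & size p = d.+1.

Definition galois_conjugate (R : realType) (a : R) (z : R[i]) : Prop :=
  exists2 p : {poly rat}, is_minpoly a p & root (map_poly ratr p) z.

(* The modulus as an element of R; the generic norm of R[i] takes its values
   in R[i] itself. *)
Definition cmod (R : realType) (z : R[i]) : R := ComplexField.Normc.normc z.

Definition salem_number (R : realType) (a : R) : Prop :=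
  [/\ integralOver (intr : int -> R) a,
      1 < a,
      forall z : R[i],
        galois_conjugate a z -> z != real_complex R a -> cmod z <= 1
    & exists z : R[i],
        [/\ galois_conjugate a z, z != real_complex R a & cmod z = 1]].

Definition frac_part (R : realType) (x : R) : R := x - (Num.floor x)%:~R.

(* The ordinals n < N.+1 are the n with 0 <= n <= N; the junk value at N = 0
   does not affect the limit. *)
Definition visit_freq (R : realType) (a eta delta : R) (N : nat) : R :=
  #|[set n : 'I_N.+1 | frac_part (eta * a ^+ n) \in `[delta, 1 - delta]]|%:R
  / N%:R.

(* Main.v *)
Require Import Defs.
From HB Require Import structures.
From mathcomp Require Import all_boot all_order all_algebra.
From mathcomp Require Import complex lra zify ring.
From mathcomp Require Import all_classical all_reals all_analysis.

Import Order.TTheory GRing.Theory Num.Theory.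
Import numFieldNormedType.Exports.

Local Open Scope ring_scope.

(* Let x_n be the trace of L eta alpha^n, an integer; then eta alpha^n equals
   x_n / L - e_n, where e_n is the contribution of the conjugates z <> alpha, all
   in the closed unit disk.  The residue of x_n mod L is governed by a finite
   state, a power of the companion matrix mod L, and the powers z^n lie in
   finitely many small cells, so the orbit mod 1 is uniformly recurrent up to any
   error.  No positive power of a conjugate z1 on the unit circle equals that of
   another conjugate or 1; hence e_n is close to a given constant only for a set
   of n of small density.  When eta alpha^n is near t mod 1, e_n is near one of
   finitely many constants r / L - t, so the orbit mod 1 has no atom.  The absence
   of atoms at delta and - delta gives the existence of the limit, and at 0 it
   makes the limit at least 1/2 once delta is small. *)

(** * Densities of sets of integers *)

Section Density.
Variable R : realType.
Implicit Types (u v w : nat -> bool) (g : nat -> R).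

Definition win u (a M : nat) : R := \sum_(k < M) (u (a + k)%N)%:R.

Lemma win_cat u a m n : win u a (m + n) = win u a m + win u (a + m) n.
Proof.
rewrite /win big_split_ord /=; congr (_ + _).
by apply: eq_bigr => i _; rewrite addnA.
Qed.

Lemma win_ge0 u a M : 0 <= win u a M.
Proof. exact: sumr_ge0. Qed.

Lemma le_win u v a M : (forall n, u n -> v n) -> win u a M <= win v a M.
Proof.
move=> uv; apply: ler_sum => i _; rewrite ler_nat.
by move: (uv (a + i)%N); case: (u _) => // ->.
Qed.

Lemma eq_win u v a M : u =1 v -> win u a M = win v a M.
Proof. by move=> uv; apply: eq_bigr => i _; rewrite uv. Qed.

Lemma win_le u a M : win u a M <= M%:R.
Proof.
rewrite -[leRHS]mulr1 mulr_natl -[in leRHS](card_ord M) -sumr_const.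
by apply: ler_sum => i _; rewrite lern1 leq_b1.
Qed.

Lemma winC u a M : win (fun n => ~~ u n) a M = M%:R - win u a M.
Proof.
apply/eqP; rewrite eq_sym subr_eq -big_split /=; apply/eqP.
rewrite -[LHS]mulr1 mulr_natl -[in LHS](card_ord M) -sumr_const.
by apply: eq_bigr => i _; case: (u _); rewrite ?addr0 ?add0r.
Qed.

(** Cutting [[0, a + M)] at [a] or at [M] turns the difference into that of two windows of length
    [a]. *)
Lemma win_shift u a M : `|win u a M - win u 0 M| <= a%:R.
Proof.
have := win_cat u 0 a M; rewrite addnC win_cat !add0n => E.
have {E} : win u a M - win u 0 M = win u M a - win u 0 a by lra.
have := win_ge0 u M a; have := win_le u M a.
have := win_ge0 u 0 a; have := win_le u 0 a => h1 h2 h3 h4 ->.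
by rewrite ler_norml; apply/andP; split; lra.
Qed.

Lemma win_recl u a M : win u a M.+1 = (u a)%:R + win u a.+1 M.
Proof. by rewrite -add1n win_cat /win big_ord1 addn0 addn1. Qed.

(* If hits of [u] at distance less than [K] are charged to [v], the remaining
   hits are [K]-separated. *)
Lemma win_separated u v K : (0 < K)%N ->
  (forall n k, (0 < k < K)%N -> u n -> u (n + k)%N -> v n) ->
  forall N, win u 0 N <= (N %/ K)%:R + 1 + win v 0 N.
Proof.
move=> K0 uv.
(* In a window of length at most [K] every hit of [u] except the last is charged to [v]. *)
have block r : forall a, (r <= K)%N -> win u a r <= 1 + win v a r.
  elim: r => [|r IH] a rK; first by rewrite /win !big_ord0; lra.
  rewrite !win_recl; have := IH a.+1 (ltnW rK).
  case ua: (u a) => /=; last first.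
    have : 0 <= (v a)%:R :> R by exact: ler0n. lra.
  case: (boolP [exists k : 'I_r, u (a.+1 + k)%N]).
    case/existsP => k uk; have -> : v a => /=; last by lra.
    by apply: (uv a k.+1); rewrite ?addnS ?(leq_trans _ rK) ?ltnS.
  move=> /existsPn nu _; have -> : win u a.+1 r = 0.
    by rewrite /win big1 // => k _; rewrite (negbTE (nu k)).
  have := win_ge0 v a.+1 r; have : 0 <= (v a)%:R :> R by exact: ler0n.
  by move=> /=; lra.
have blocks q r : (r <= K)%N ->
    forall a, win u a (q * K + r) <= q%:R + 1 + win v a (q * K + r).
  move=> rK; elim: q => [|q IH] a; first by rewrite mul0n !add0n add0r block.
  rewrite mulSn -addnA !(win_cat _ _ K) -natr1.
  by have := IH (a + K)%N; have := block K a (leqnn _); lra.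
move=> N; rewrite {1 3}(divn_eq N K); apply: blocks.
exact/ltnW/ltn_pmod.
Qed.

(** Cut into blocks of length [M], a long window has nearly the mean of the first block, so the
    means form a Cauchy sequence. *)
Lemma cvg_mean u :
  (forall e, 0 < e ->
     exists2 M, (0 < M)%N & forall a, `|win u a M - win u 0 M| <= e * M%:R) ->
  cvgn (fun N => win u 0 N.+1 / N%:R).
Proof.
move=> H; apply: cauchy_cvg; apply: cauchy_exP => e e0.
have e3 : 0 < e / 4 by lra.
have [M M0 HM] := H _ e3.
have MR : 0 < M%:R :> R by rewrite ltr0n.
pose m := win u 0 M / M%:R.
have m0 : 0 <= m by rewrite divr_ge0 ?win_ge0 // ltW.
have m1 : m <= 1 by rewrite ler_pdivrMr // mul1r win_le.
exists m.
have Q q r a : (r < M)%N ->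
    `|win u a (q * M + r) - (q * M)%:R * m| <= (q * M)%:R * (e / 4) + M%:R.
  move=> rM; elim: q a => [|q IH] a.
    rewrite mul0n add0n !mul0r subr0 add0r ger0_norm ?win_ge0 //.
    by rewrite (le_trans (win_le _ _ _)) // ler_nat ltnW.
  rewrite mulSn -addnA win_cat !natrD.
  have := IH (a + M)%N; have := HM a.
  have -> : win u 0 M = M%:R * m by rewrite mulrC divfK // gt_eqF.
  rewrite !ler_norml => /andP[? ?] /andP[? ?]; apply/andP; split; lra.
(* Beyond [N0] the boundary errors are below [N%:R * (e / 4)]: one [M] for the incomplete block,
   another for replacing [q] by [N], and [e / 4] for the extra term of [N.+1]. *)
pose N0 := (Num.truncn ((e / 4 + 2 * M%:R) / (e / 4))).+1.
exists N0 => //= N /= N0N; rewrite /ball /=.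
have NN : (e / 4 + 2 * M%:R) / (e / 4) < N%:R.
  by apply: lt_le_trans (truncnS_gt _) _; rewrite ler_nat.
have N_gt0 : 0 < N%:R :> R.
  by apply: le_lt_trans NN; rewrite divr_ge0 // ltW //; lra.
have {}NN : e / 4 + 2 * M%:R < N%:R * (e / 4) by rewrite -ltr_pdivrMr.
have rM : (N.+1 %% M < M)%N by rewrite ltn_pmod.
have := Q (N.+1 %/ M)%N (N.+1 %% M)%N 0%N rM; rewrite -divn_eq.
have : (N.+1 %/ M * M)%:R + (N.+1 %% M)%:R = N%:R + 1 :> R.
  by rewrite -natrD -divn_eq natr1.
have : (N.+1 %% M)%:R <= M%:R :> R by rewrite ler_nat ltnW.
have : 0 <= (N.+1 %% M)%:R :> R by [].
have : 1 <= M%:R :> R by rewrite ler1n.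
move: ((N.+1 %/ M * M)%:R : R) ((N.+1 %% M)%:R : R) => q r hM hr0 hr hq.
rewrite ler_norml => /andP[h1 h2].
have E : m - win u 0 N.+1 / N%:R = (N%:R * m - win u 0 N.+1) / N%:R.
  by rewrite mulrBl mulrAC divff ?gt_eqF // mul1r.
rewrite E normrM normfV (gtr0_norm N_gt0) ltr_pdivrMr // ltr_norml.
have : `|(q - N%:R) * m| <= M%:R.
  rewrite normrM (ger0_norm m0) -[leRHS]mulr1 ler_pM //.
  by rewrite ler_norml; apply/andP; split; lra.
rewrite ler_norml => /andP[h3 h4].
have h5 : q * (e / 4) <= (N%:R + 1) * (e / 4) by rewrite ler_pM2r //; lra.
by apply/andP; split; lra.
Qed.

(** The upper density of the sublevel set at height [e] tends to 0 with [e]: a nonnegative [g] has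
    no atom at 0. *)
Definition sublevels_vanish g := forall h, 0 < h ->
  exists2 e, 0 < e & exists N0, forall N, (N0 <= N)%N ->
    win (fun n => g n <= e) 0 N <= h * N%:R.

Lemma sublevels_vanish_bounded g c :
  0 < c -> (forall n, c <= g n) -> sublevels_vanish g.
Proof.
move=> c0 cg h h0; exists (c / 2); first by lra.
exists 0%N => N _; rewrite /win big1 ?mulr_ge0 ?(ltW h0) // => k _.
by rewrite leNgt (lt_le_trans _ (cg _)) //; lra.
Qed.

(** Half of [h] goes to the head and half to the tail, and the smaller threshold serves both. *)
Lemma sublevels_vanish_has (I : Type) (s : seq I) (g : I -> nat -> R) h :
  (forall i, sublevels_vanish (g i)) -> 0 < h ->
  exists2 e, 0 < e & exists N0, forall N, (N0 <= N)%N ->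
    win (fun n => has (fun i => g i n <= e) s) 0 N <= h * N%:R.
Proof.
move=> Hg; elim: s h => [|i s IH] h h0.
  by exists 1 => //; exists 0%N => N _; rewrite /win big1 ?mulr_ge0 ?(ltW h0).
have h2 : 0 < h / 2 by lra.
have [e1 e10 [N1 H1]] := Hg i _ h2; have [e2 e20 [N2 H2]] := IH _ h2.
exists (Num.min e1 e2); first by rewrite lt_min e10.
exists (maxn N1 N2) => N; rewrite geq_max => /andP[/H1 {}H1 /H2 {}H2].
have : win (fun n => has (fun i => g i n <= Num.min e1 e2) (i :: s)) 0 N <=
    win (fun n => g i n <= e1) 0 N +
    win (fun n => has (fun i => g i n <= e2) s) 0 N.
  rewrite /win -big_split; apply: ler_sum => k _ /=; rewrite -natrD ler_nat.
  case: (boolP (g i k <= Num.min e1 e2)) => [|_].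
    by rewrite le_min => /andP[->]; rewrite add1n.
  have le2 i' : g i' k <= Num.min e1 e2 -> g i' k <= e2.
    by rewrite le_min => /andP[].
  have := sub_has le2 (s := s); rewrite /=.
  case: (has _ s) => [/(_ isT) ->|_]; last by [].
  by rewrite addn1.
by lra.
Qed.
End Density.

(** * Exponential sums with frequencies in the closed unit disk *)

Section ExponentialSums.
Variable R : realType.
Implicit Types (z c : R[i]).

Lemma cmodM (x y : R[i]) : cmod (x * y) = cmod x * cmod y.
Proof. exact: ComplexField.Normc.normcM. Qed.

Lemma cmodX (x : R[i]) n : cmod (x ^+ n) = cmod x ^+ n.
Proof.
elim: n => [|n IH]; first exact: ComplexField.Normc.normc1.
by rewrite !exprS cmodM IH.
Qed.

Lemma cmodD (x y : R[i]) : cmod (x + y) <= cmod x + cmod y.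
Proof. exact: le_normcD. Qed.

Lemma cmodN (x : R[i]) : cmod (- x) = cmod x.
Proof. exact: normcN. Qed.

Lemma cmod_real (x : R) : cmod (real_complex R x) = `|x|.
Proof. by rewrite /cmod /= expr0n addr0 sqrtr_sqr. Qed.

Lemma cmod_gt0 (x : R[i]) : x != 0 -> 0 < cmod x.
Proof.
move=> x0; rewrite lt_neqAle eq_sym; apply/andP; split.
  by apply: contra x0 => /eqP /ComplexField.Normc.eq0_normc ->.
by case: x {x0} => a b; exact: sqrtr_ge0.
Qed.

Lemma cmod_ge0 (x : R[i]) : 0 <= cmod x.
Proof. by case: x => a b; exact: sqrtr_ge0. Qed.

(* Induction on the number of frequencies: [f (n + k) - z ^+ k * f n] loses the
   frequency [z], keeps [z1] and is small when [f n] and [f (n + k)] are, so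
   the [n] at which [f] is small are sparse up to a set of small density. *)
Lemma sublevels_vanish_expsum (s : seq (R[i] * R[i])) c1 z1 :
  c1 != 0 -> cmod z1 = 1 -> (forall x, x \in s -> cmod x.2 <= 1) ->
  (forall x k, x \in s -> (0 < k)%N -> z1 ^+ k != x.2 ^+ k) ->
  sublevels_vanish R
    (fun n => cmod (c1 * z1 ^+ n + \sum_(x <- s) x.1 * x.2 ^+ n)).
Proof.
move: {2}(size s) (erefl (size s)) => m sm c1n z1n.
elim: m s sm c1 c1n => [|m IH] [|[c z] s] //= => [_|[sm]] c1 c1n sn sk.
  apply: (@sublevels_vanish_bounded _ _ (cmod c1)); first exact: cmod_gt0.
  by move=> n; rewrite big_nil addr0 cmodM cmodX z1n expr1n mulr1.
pose f n := c1 * z1 ^+ n + \sum_(x <- (c, z) :: s) x.1 * x.2 ^+ n.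
pose g i n := cmod (f (n + i.+1)%N - z ^+ i.+1 * f n).
have Hg i : sublevels_vanish R (g i).
  (* The difference multiplies the coefficient of a frequency [w] by [w ^+ i.+1 - z ^+ i.+1]; this
     kills the term of [z], while the coefficient at [z1] stays nonzero. *)
  pose s' := [seq (x.1 * (x.2 ^+ i.+1 - z ^+ i.+1), x.2) | x <- s].
  have -> : g i = fun n => cmod (c1 * (z1 ^+ i.+1 - z ^+ i.+1) * z1 ^+ n +
      \sum_(x <- s') x.1 * x.2 ^+ n).
    apply/funext => n; rewrite /g /f !big_cons /= big_map; congr cmod.
    rewrite !exprD [in RHS](eq_bigr (fun x =>
      x.1 * (x.2 ^+ (n + i.+1)) - z ^+ i.+1 * (x.1 * x.2 ^+ n))); last first.
      by move=> x _; rewrite /= exprD; ring.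
    by rewrite sumrB -mulr_sumr; ring.
  apply: IH; rewrite ?size_map //.
  - by rewrite mulf_neq0 // subr_eq0 (sk (c, z)) ?mem_head.
  - by move=> x /mapP[y ys ->] /=; apply: sn; rewrite inE ys orbT.
  - by move=> x k /mapP[y ys ->] /=; apply: sk; rewrite inE ys orbT.
have zn : cmod z <= 1 by apply: (sn (c, z)); exact: mem_head.
move=> h h0.
have h2 : 0 < h / 2 by lra.
(* Hits that are [K]-separated contribute at most [h / 4] to the density, and the additive 1 is at
   most another [h / 4] once [K <= N]; the charged hits take the remaining [h / 2]. *)
pose K := (Num.truncn (4 / h)).+1.
have hK : 4 / h < K%:R by exact: truncnS_gt.
have [e e0 [N0 H]] := sublevels_vanish_has _ _ (iota 0 K) g _ Hg h2.
(* Since [cmod z <= 1], two values of [f] of size at most [e / 2] give a value of [g] of size at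
   most [e]. *)
exists (e / 2); first by lra.
exists (maxn N0 K) => N; rewrite geq_max => /andP[/H {}H KN].
have sep := @win_separated R (fun n => cmod (f n) <= e / 2)
  (fun n => has (fun i => g i n <= e) (iota 0 K)) K isT _ N.
apply: le_trans (sep _) _ => {sep} [n [//|k] kK fn fnk|].
  apply/hasP; exists k; first by rewrite mem_iota add0n; case/andP: kK => _ /ltnW.
  apply: le_trans (cmodD _ _) _; rewrite cmodN cmodM cmodX.
  have : cmod z ^+ k.+1 * cmod (f n) <= 1 * (e / 2).
    by rewrite ler_pM ?exprn_ge0 ?cmod_ge0 // exprn_ile1 // cmod_ge0.
  lra.
have : 4 / h < N%:R by apply: lt_le_trans hK _; rewrite ler_nat.
rewrite ltr_pdivrMr // => hN.
have : (N %/ K)%:R * 4 <= N%:R * h.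
  apply: le_trans (_ : (N %/ K)%:R * (K%:R * h) <= _).
    rewrite ler_wpM2l //; move: hK; rewrite ltr_pdivrMr //; exact: ltW.
  by rewrite mulrA -natrM ler_pM2r // ler_nat leq_divM.
lra.
Qed.
End ExponentialSums.

(** * Powers of the conjugates *)

Section IntegerPowerSums.
Variables (F : fieldType) (p : {poly int}) (rs : seq F).
Hypotheses (rs_uniq : uniq rs)
  (p_rs : map_poly intr p = \prod_(z <- rs) ('X - z%:P)) (p_monic : p \is monic).
Let m := size rs.
Let z : 'rV[F]_m := \row_j rs`_j.
Let V : 'M[F]_m := Vandermonde m z.

(** On the column of powers [1, x, ..., x ^+ m.-1] of a root [x] this matrix acts as multiplication
    by [x]; the last row rewrites [x ^+ m] by means of [p]. *)
Definition companion : 'M[int]_m :=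
  \matrix_(i, j) if i.+1 == m then - p`_j else (i.+1 == j)%:R.

Let AF := map_mx (intr : int -> F) companion.

Let V_unit : V \in unitmx.
Proof.
rewrite unitmxE det_Vandermonde unitfE.
rewrite prodf_seq_neq0; apply/allP => i _ /=.
rewrite prodf_seq_neq0; apply/allP => j _ /=; apply/implyP => ij.
by rewrite !mxE subr_eq0 nth_uniq // neq_ltn ij orbT.
Qed.

Let size_p : size p = m.+1.
Proof.
have := congr1 (fun q : {poly F} => size q) p_rs.
by rewrite size_prod_XsubC size_map_poly_id0 // (monicP p_monic) oner_eq0.
Qed.

Let companion_Vandermonde : AF *m V = V *m diag_mx z.
Proof.
apply/matrixP => i j; rewrite mul_mx_diag !mxE -exprSr.
transitivity (\sum_(k < m) AF i k * rs`_j ^+ k).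
  by apply: eq_bigr => k _; rewrite !mxE.
case: (eqVneq i.+1 m) => im.
  have : (map_poly intr p).[rs`_j] = 0.
    by apply/rootP; rewrite p_rs root_prod_XsubC mem_nth.
  rewrite (horner_coef_wide _ (n := m.+1)) ?size_map_poly_id0 ?size_p //; last first.
    by rewrite (monicP p_monic) oner_eq0.
  have pm : p`_m = 1 by have /monicP := p_monic; rewrite /lead_coef size_p.
  rewrite big_ord_recr /= coef_map pm mul1r => /eqP.
  rewrite addrC addr_eq0 im => /eqP ->; rewrite -sumrN; apply: eq_bigr => k _.
  by rewrite !mxE im eqxx coef_map /= rmorphN mulNr.
have im' : (i.+1 < m)%N by rewrite ltn_neqAle im; exact: ltn_ord.
rewrite (bigD1 (Ordinal im')) //= big1 => [|k ki].
  by rewrite !mxE /= (negbTE im) eqxx mul1r addr0.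
rewrite !mxE (negbTE im); case: eqP => [ik|_]; last by rewrite mul0r.
by case/eqP: ki; apply: val_inj.
Qed.

Let companion_exp k : map_mx intr (companion ^+ k) *m V =
  V *m diag_mx (\row_j z 0 j ^+ k).
Proof.
elim: k => [|k IH].
  have -> : map_mx intr (companion ^+ 0) = 1%:M :> 'M[F]_m.
    by rewrite expr0; exact: map_mx1.
  rewrite mul1mx.
  rewrite -[LHS]mulmx1; congr (_ *m _); apply/matrixP => i j.
  by rewrite !mxE expr0.
rewrite exprS -[companion * _]/(companion *m _) map_mxM -mulmxA IH mulmxA.
rewrite companion_Vandermonde -mulmxA; congr (_ *m _).
by apply/matrixP => i j; rewrite mul_diag_mx !mxE exprS mulrnAr.
Qed.

(** The roots are distinct, so the Vandermonde matrix is invertible and diagonalizes [companion].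
    Power sums of the roots thus become integers read off from an integer matrix. *)
Lemma mxtrace_companion_exp k :
  (\tr (companion ^+ k))%:~R = \sum_(x <- rs) x ^+ k.
Proof.
have -> : (\tr (companion ^+ k))%:~R = \tr (map_mx (intr : int -> F) (companion ^+ k)).
  by rewrite trace_map_mx.
rewrite -[map_mx _ _](mulmxK V_unit) companion_exp mxtrace_mulC mulKmx //.
rewrite mxtrace_diag (big_nth 0) big_mkord.
by apply: eq_bigr => i _; rewrite !mxE.
Qed.

(** This descends the product over the [k]-th powers, with their multiplicities, to integer
    coefficients, even when some of these powers coincide. *)
Lemma char_poly_companion_exp k :
  map_poly intr (char_poly (companion ^+ k)) = \prod_(x <- rs) ('X - (x ^+ k)%:P).
Proof.
rewrite map_char_poly.
pose D := diag_mx (\row_j z 0 j ^+ k).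
set B := map_mx _ _.
have BV : B *m V = V *m D by exact: companion_exp.
have : char_poly B * \det (map_mx polyC V) = \det (map_mx polyC V) * char_poly D.
  rewrite -!det_mulmx; congr (\det _); rewrite /char_poly_mx.
  by rewrite mulmxBl mulmxBr -!map_mxM BV scalar_mxC.
rewrite mulrC => /mulfI ->.
  rewrite char_poly_trig ?diag_mx_is_trig // (big_nth 0) big_mkord.
  by apply: eq_bigr => i _; rewrite !mxE eqxx.
by rewrite det_map_mx polyC_eq0 -unitfE -unitmxE.
Qed.
End IntegerPowerSums.

(** Otherwise [p] and [q] are coprime, and coprimality persists in [K], where it excludes a common
    root. *)
Lemma irreducible_dvdp_root (F : fieldType) (K : idomainType) (iota : {rmorphism F -> K})
    (p q : {poly F}) x :
  irreducible_poly p -> root (map_poly iota p) x -> root (map_poly iota q) x ->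
  p %| q.
Proof.
move=> p_irr px qx; apply: contraT; rewrite -irreducible_poly_coprime //.
rewrite -(coprimep_map iota) => /coprimep_root /(_ px).
by rewrite (rootP qx) eqxx.
Qed.

(** By the product rule, only the term without the factor of [a] survives at [f a]. *)
Lemma root_deriv_prod_XsubC (F : idomainType) (I : eqType) (s : seq I) (f : I -> F) a :
  a \in s ->
  root (\prod_(x <- s) ('X - (f x)%:P))^`() (f a) =
  has (fun x => f x == f a) (rem a s).
Proof.
move=> sa; rewrite (big_rem a) //= derivM derivXsubC mul1r rootE !hornerE subrr.
rewrite mul0r addr0 horner_prod prodf_seq_eq0; apply: eq_has => x /=.
by rewrite !hornerE subr_eq0 eq_sym.
Qed.

(* If [C] is the polynomial of the [k]-th powers, then [gcdp C C^`()] composed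
   with ['X^k] vanishes at one conjugate iff it vanishes at all. *)
Lemma conjugate_powers_collide (F : numFieldType) (p : {poly rat}) (C : {poly rat})
    (rs : seq F) k a b c :
  irreducible_poly p -> uniq rs ->
  map_poly ratr p = \prod_(x <- rs) ('X - x%:P) ->
  map_poly ratr C = \prod_(x <- rs) ('X - (x ^+ k)%:P) ->
  [/\ a \in rs, b \in rs & c \in rs] -> c != b -> c ^+ k = b ^+ k ->
  exists x, [/\ x \in rs, x != a & x ^+ k = a ^+ k].
Proof.
move=> p_irr rs_uniq p_rs C_rs [sa sb sc] cb ck.
have rsr (x : F) : x \in rs -> root (map_poly ratr p) x by rewrite p_rs root_prod_XsubC.
have Gr (x : F) : root (map_poly ratr (gcdp C C^`() \Po 'X^k)) x =
    root (map_poly ratr C) (x ^+ k) && root (map_poly ratr C)^`() (x ^+ k).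
  rewrite map_comp_poly map_polyXn /root horner_comp hornerXn.
  rewrite -/(root _ _) -/(root _ _) -/(root _ _).
  by rewrite gcdp_map root_gcd deriv_map.
(* As [c ^+ k = b ^+ k], the value [b ^+ k] is a multiple root of [C], so the composed gcd vanishes
   at [b]. *)
have dvd : p %| gcdp C C^`() \Po 'X^k.
  apply: (irreducible_dvdp_root _ _ _ _ _ b p_irr (rsr _ sb)).
  rewrite Gr C_rs (root_deriv_prod_XsubC _ _ _ (fun x => x ^+ k)) //.
  rewrite (big_rem b) //= rootM root_XsubC eqxx /=.
  by apply/hasP; exists c; rewrite ?ck //= mem_rem_uniq // !inE cb.
have : root (map_poly ratr (gcdp C C^`() \Po 'X^k)) a.
  by apply: root_dvdp (rsr _ sa); rewrite dvdp_map.
rewrite Gr C_rs (root_deriv_prod_XsubC _ _ _ (fun x => x ^+ k)) // => /andP[_].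
by case/hasP => x; rewrite mem_rem_uniq // !inE => /andP[? ?] /eqP; exists x.
Qed.

(** Gauss's lemma: an integer polynomial proportional to [p] divides a monic one over the integers.
    Its leading coefficient is then a unit, and a sign makes it monic. *)
Lemma minpoly_int (R : realType) (a : R) (p : {poly rat}) :
  integralOver (intr : int -> R) a -> is_minpoly a p ->
  exists2 P : {poly int}, P \is monic & p = map_poly intr P.
Proof.
move=> [q q_monic qa] [p_monic p_irr pa].
have : p %| map_poly intr q.
  apply: (irreducible_dvdp_root _ _ _ _ _ a p_irr pa).
  rewrite -map_poly_comp (eq_map_poly (g := intr)) // => x /=.
  exact: rmorph_int.
move=> /dvdpP_rat_int[P [c c0 pE] [r qE]].
have Pu : lead_coef P * lead_coef r = 1 by rewrite -lead_coefM -qE (monicP q_monic).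
have P1 : lead_coef P * lead_coef P = 1.
  have : lead_coef P \is a GRing.unit by apply/unitrPr; exists (lead_coef r).
  by case/orP => /eqP ->.
exists (lead_coef P *: P); first by rewrite monicE lead_coefZ P1.
have := monicP p_monic; rewrite pE lead_coefZ lead_coef_map_inj //; last exact: intr_inj.
rewrite map_polyZ => cP; congr (_ *: _).
have L0 : (lead_coef P)%:~R != 0 :> rat.
  apply: contraTneq isT => L0; move: cP; rewrite L0 mulr0 => /eqP.
  by rewrite eq_sym oner_eq0.
by apply: (mulIf L0); rewrite cP /= -intrM P1.
Qed.

(** * Recurrence *)

(** The relation only has to contain the kernel of a map to a finite type, so closeness within [e],
    which is not transitive, qualifies. *)
Definition finitely_coloured (P : nat -> nat -> Prop) : Prop :=
  exists (T : finType) (c : nat -> T), forall a b, c a = c b -> P a b.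

Lemma finitely_coloured_and P Q :
  finitely_coloured P -> finitely_coloured Q ->
  finitely_coloured (fun a b => P a b /\ Q a b).
Proof.
move=> [T [c H]] [T' [c' H']]; exists (T * T')%type, (fun n => (c n, c' n)).
by move=> a b [/H ? /H' ?].
Qed.

Lemma finitely_coloured_all (I : eqType) (s : seq I) (P : I -> nat -> nat -> Prop) :
  (forall i, i \in s -> finitely_coloured (P i)) ->
  finitely_coloured (fun a b => forall i, i \in s -> P i a b).
Proof.
elim: s => [|i s IH] H; first by exists unit, (fun=> tt).
have [|T [c Hc]] := finitely_coloured_and _ _ (H i (mem_head _ _)) (IH _).
  by move=> j js; apply: H; rewrite inE js orbT.
exists T, c => a b /Hc[Pi Ps] j; rewrite inE => /orP[/eqP -> //|]; exact: Ps.
Qed.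

(** Every colour that occurs gets one representative, and [l] is the largest of them. *)
Lemma finitely_coloured_recurs P : finitely_coloured P ->
  exists l, forall a, exists2 b, (b <= l)%N & P a b.
Proof.
move=> [T [c H]].
have : forall x : T, exists n, (exists a, c a = x) -> c n = x.
  move=> x; have [[n nx]|] := pselect (exists a, c a = x); first by exists n.
  by exists 0%N.
move=> /choice[f Hf]; exists (\max_(x : T) f x)%N => a.
exists (f (c a)); first exact: (leq_bigmax (c a)).
by apply: H; rewrite Hf //; exists a.
Qed.

Section Colourings.
Variable R : realType.

Lemma finitely_coloured_real (v : nat -> R) B e : 0 < e ->
  (forall n, `|v n| <= B) -> finitely_coloured (fun a b => `|v a - v b| <= e).
Proof.
move=> e0 vB; pose w n := Num.truncn ((v n + B) / e).
have w0 n : 0 <= (v n + B) / e.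
  by rewrite divr_ge0 ?(ltW e0) //; have := vB n; rewrite ler_norml; lra.
pose K := Num.truncn (2 * B / e).
have wK n : (w n <= K)%N.
  apply: le_truncn; rewrite ler_pM2r ?invr_gt0 //.
  by have := vB n; rewrite ler_norml; lra.
exists 'I_K.+1, (fun n => inord (w n)) => a b /(congr1 val) /=.
rewrite !inordK ?ltnS ?wK // => wab.
have /andP[a1 a2] := truncn_itv (w0 a); have /andP[b1 b2] := truncn_itv (w0 b).
move: a1 a2 b1 b2; rewrite -/(w a) -/(w b) wab -!natr1.
rewrite !ler_pdivlMr // !ltr_pdivrMr // => a1 a2 b1 b2.
by rewrite ler_norml; apply/andP; split; lra.
Qed.

Lemma normr_Re_le (x : R[i]) : `|complex.Re x| <= cmod x.
Proof.
by case: x => a b; rewrite /cmod /= -sqrtr_sqr ler_wsqrtr // lerDl sqr_ge0.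
Qed.

Lemma normr_Im_le (x : R[i]) : `|complex.Im x| <= cmod x.
Proof.
by case: x => a b; rewrite /cmod /= -sqrtr_sqr ler_wsqrtr // lerDr sqr_ge0.
Qed.

Lemma cmod_le_ReIm (x : R[i]) : cmod x <= `|complex.Re x| + `|complex.Im x|.
Proof.
case: x => a b; rewrite /cmod /=.
rewrite -[leRHS]ger0_norm ?addr_ge0 // -sqrtr_sqr ler_wsqrtr //.
rewrite sqrrD !real_normK ?num_real // [leRHS]addrAC.
by rewrite lerDl mulrn_wge0 // mulr_ge0.
Qed.

Lemma finitely_coloured_complex (v : nat -> R[i]) B e : 0 < e ->
  (forall n, cmod (v n) <= B) -> finitely_coloured (fun a b => cmod (v a - v b) <= e).
Proof.
move=> e0 vB; have e2 : 0 < e / 2 by lra.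
have [||T [c H]] := finitely_coloured_and _ _
  (finitely_coloured_real (fun n => complex.Re (v n)) B _ e2 _)
  (finitely_coloured_real (fun n => complex.Im (v n)) B _ e2 _).
- by move=> n; apply: le_trans (normr_Re_le _) (vB n).
- by move=> n; apply: le_trans (normr_Im_le _) (vB n).
exists T, c => a b /H[]; have := cmod_le_ReIm (v a - v b).
by rewrite !raddfB /=; lra.
Qed.
End Colourings.

(** The colour is the matrix of residues. Divisibility of the difference is the form that survives
    multiplication by a further matrix. *)
Lemma finitely_coloured_mx m (u : nat -> 'M[int]_m) (L : nat) : (0 < L)%N ->
  finitely_coloured (fun a b => exists D, u a - u b = L%:Z *: D).
Proof.
move=> L0.
have Lz : L%:Z != 0 by rewrite eqz_nat -lt0n.
exists 'M['I_L]_m,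
  (fun n => \matrix_(i, j) Ordinal (ltn_pmod (`|(u n i j %% L)%Z|%N) L0)).
move=> a b /matrixP E; exists (\matrix_(i, j) ((u a i j - u b i j) %/ L)%Z).
apply/matrixP => i j; rewrite !mxE mulrC divzK //.
have := E i j; rewrite !mxE => /(congr1 val) /=.
have lt n : (`|(u n i j %% L)%Z| < L)%N.
  by rewrite -ltz_nat gez0_abs ?modz_ge0 // ltz_pmod.
rewrite !modn_small // => /(congr1 Posz); rewrite !gez0_abs ?modz_ge0 // => /eqP.
by rewrite eqz_mod_dvd.
Qed.

(** * Visits to an interval *)

Section FractionalPart.
Variable R : realType.
Implicit Types x y : R.

(** Distances to integers make the condition visibly invariant under integer translation and sign
    change. *)
Lemma frac_part_itvP x d : 0 < d ->
  reflect (forall m : int, d <= `|x - m%:~R|) (frac_part x \in `[d, 1 - d]).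
Proof.
move=> d0; rewrite in_itv /=; have /andP[f1 f2] := floor_itv x.
rewrite intrD in f2.
have f0 : x = (Num.floor x)%:~R + frac_part x by rewrite /frac_part addrC subrK.
rewrite /frac_part; apply: (iffP andP) => [[h1 h2] m|H].
  have [mf|fm] := leP m (Num.floor x).
    have : m%:~R <= (Num.floor x)%:~R :> R by rewrite ler_int.
    by move=> ?; rewrite ler_normr; apply/orP; left; lra.
  have : (Num.floor x + 1)%:~R <= m%:~R :> R by rewrite ler_int lezD1.
  by rewrite intrD => ?; rewrite ler_normr; apply/orP; right; lra.
have := H (Num.floor x); rewrite ger0_norm; last by lra.
have := H (Num.floor x + 1); rewrite intrD ler0_norm; last by lra.
by split; lra.
Qed.

Lemma frac_part_itvN x d : 0 < d ->
  (frac_part (- x) \in `[d, 1 - d]) = (frac_part x \in `[d, 1 - d]).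
Proof.
move=> d0; apply/(frac_part_itvP _ _ d0)/(frac_part_itvP _ _ d0) => H m.
  by have := H (- m); rewrite rmorphN opprK addrC -normrN opprD opprK addrC.
by have := H (- m); rewrite rmorphN opprK -opprD normrN.
Qed.

Definition near_int (e x : R) : bool := `[< exists m : int, `|x - m%:~R| <= e >].

(** Modulo 1 the endpoints of the interval are [d] and [- d], and a displacement of at most [e]
    changes membership only by crossing one of them. *)
Lemma frac_part_itv_flip x y d e : 0 < d -> near_int e (x - y) ->
  (frac_part x \in `[d, 1 - d]) != (frac_part y \in `[d, 1 - d]) ->
  near_int e (y - d) || near_int e (y + d).
Proof.
move=> d0 /asboolP[m xy].
(* Here [s] and [s'] stand for integer translates of [y] and [x], with absolute values on opposite
   sides of [d]. *)
have key s s' (k : int) : y = s + k%:~R -> `|s' - s| <= e ->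
    (`|s| < d <= `|s'|) || (`|s'| < d <= `|s|) ->
    near_int e (y - d) || near_int e (y + d).
  move=> -> ss; rewrite !ltr_norml !ler_normr => H.
  have : (`|s - d| <= e) || (`|s + d| <= e).
    move: ss; rewrite !ler_norml.
    move: H => /orP[] /andP[/andP[? ?] /orP[?|?]] /andP[? ?];
      by apply/orP; (left + right); apply/andP; split; lra.
  by case/orP=> h; apply/orP; [left|right]; apply/asboolP; exists k;
    rewrite addrAC addrK.
have ssE k : x - (m + k)%:~R - (y - k%:~R) = x - y - m%:~R :> R.
  by rewrite intrD; lra.
case: (frac_part_itvP x _ d0) => Hx; case: (frac_part_itvP y _ d0) => Hy // _.
  have /existsNP[k /negP] := Hy; rewrite -ltNge => yk.
  apply: (key (y - k%:~R) (x - (m + k)%:~R) k); rewrite ?ssE ?subrK //.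
  by rewrite yk Hx.
have /existsNP[k /negP] := Hx; rewrite -ltNge => xk.
apply: (key (y - (k - m)%:~R) (x - (m + (k - m))%:~R) (k - m)); rewrite ?ssE ?subrK //.
by rewrite [m + _]addrC subrK xk Hy orbT.
Qed.
End FractionalPart.

Section VisitFrequency.
Variables (R : realType) (y : nat -> R).
Hypothesis vanish : forall t h, 0 < h ->
  exists2 e, 0 < e & exists N0, forall N, (N0 <= N)%N ->
    win R (fun n => near_int R e (y n - t)) 0 N <= h * N%:R.
Hypothesis recurs : forall e, 0 < e ->
  exists l, forall a, exists2 b, (b <= l)%N &
    forall k, near_int R e (y (a + k)%N - y (b + k)%N).

Let visit d n := frac_part (y n) \in `[d, 1 - d].

Lemma near_int_le e e' (x : R) : e <= e' -> near_int R e x -> near_int R e' x.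
Proof. by move=> ee /asboolP[m /le_trans/(_ ee) ?]; apply/asboolP; exists m. Qed.

(** Recurrence compares any window with one starting at some [b <= l]. The two differ only where the
    orbit is near [d] or [- d], and moving the start from [b] to 0 costs at most [b]. *)
Lemma cvg_visit d : 0 < d -> cvgn (fun N => win R (visit d) 0 N.+1 / N%:R).
Proof.
move=> d0; apply: cvg_mean => h h0.
have h4 : 0 < h / 8 by lra.
have [e1 e10 [N1 H1]] := vanish d _ h4.
have [e2 e20 [N2 H2]] := vanish (- d) _ h4.
pose e := Num.min e1 e2; have e0 : 0 < e by rewrite lt_min e10.
have [l Hl] := recurs _ e0.
(* [M] is large enough for both density bounds and makes the cost [l] of the shift at most [h / 8]
   of the window. *)
pose M := maxn (maxn N1 N2) (Num.truncn (l%:R / (h / 8))).+1.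
exists M => [|a]; first by rewrite leq_max orbT.
have [b bl Hb] := Hl a.
have lM : l%:R <= M%:R * (h / 8).
  rewrite -ler_pdivrMr // (le_trans (ltW (truncnS_gt _))) //.
  by rewrite ler_nat leq_maxr.
have bM : b%:R <= M%:R * (h / 8) :> R by apply: le_trans lM; rewrite ler_nat.
pose D n := near_int R e (y n - d) || near_int R e (y n + d).
have flip : `|win R (visit d) a M - win R (visit d) b M| <= win R D b M.
  rewrite /win -sumrB (le_trans (ler_norm_sum _ _ _)) //; apply: ler_sum => k _.
  have := frac_part_itv_flip _ _ _ _ _ d0 (Hb k); rewrite -/(D _) /visit.
  case: (_ \in _); case: (_ \in _) => //= H; rewrite ?subrr ?normr0 //.
    by rewrite H // subr0 normr1.
  by rewrite H // sub0r normrN normr1.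
have DbM : win R D b M <= (h / 4) * (b%:R + M%:R).
  apply: le_trans (_ : win R D 0 (b + M) <= _).
    by rewrite win_cat add0n lerDr win_ge0.
  have N1M : (N1 <= b + M)%N by rewrite (leq_trans _ (leq_addl _ _)) // !leq_max leqnn.
  have N2M : (N2 <= b + M)%N by rewrite (leq_trans _ (leq_addl _ _)) // !leq_max leqnn orbT.
  have := H1 _ N1M; have := H2 _ N2M; rewrite -natrD => h2 h1.
  have : win R D 0 (b + M) <= win R (fun n => near_int R e1 (y n - d)) 0 (b + M) +
                            win R (fun n => near_int R e2 (y n - - d)) 0 (b + M).
    rewrite /win -big_split; apply: ler_sum => k _ /=; rewrite -natrD ler_nat /D opprK.
    case E1: (near_int _ _ (_ - _)) => /=.
      by rewrite (near_int_le _ _ _ _ E1) ?ge_min ?lexx // add1n.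
    case E2: (near_int _ _ _) => //=.
    by rewrite (near_int_le _ _ _ _ E2) ?ge_min ?lexx ?orbT // addn1.
  lra.
(* For [h <= 1] the bound on [b] gives [b + M <= 2 * M]; for [1 < h] the claim is trivial, as both
   counts lie between 0 and [M]. *)
have h1 : h <= 1 \/ 1 < h by case: (leP h 1); [left|right].
have bM' : b%:R + M%:R <= M%:R * (1 + h / 8) :> R by lra.
have := win_shift R (visit d) b M.
move: flip; rewrite !ler_norml => /andP[? ?] /andP[? ?].
case: h1 => h1.
  have : (h / 4) * (b%:R + M%:R) <= (h / 4) * (M%:R * 2).
    rewrite ler_pM2l; last by lra.
    apply: le_trans bM' _; rewrite ler_pM2l ?ltr0n ?leq_max ?orbT //; lra.
  by move=> ?; apply/andP; split; lra.
have hM : M%:R <= h * M%:R by rewrite ler_peMl // ltW.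
have := win_le R (visit d) a M; have := win_le R (visit d) 0 M.
have := win_ge0 R (visit d) a M; have := win_ge0 R (visit d) 0 M.
by move=> *; apply/andP; split; lra.
Qed.

Lemma visit_half : exists d, [/\ 0 < d < 1 / 2,
  cvgn (fun N => win R (visit d) 0 N.+1 / N%:R) &
  1 / 2 <= limn (fun N => win R (visit d) 0 N.+1 / N%:R)].
Proof.
have half : 0 < 1 / 2 :> R by lra.
have [e e0 [N0 H]] := vanish 0 _ half.
(* A miss lies within [d <= e] of an integer, so misses have density at most 1/2; the 1/4 keeps [d]
   below 1/2. *)
pose d := Num.min e (1 / 4); have d0 : 0 < d by rewrite lt_min e0; lra.
have d4 : d <= 1 / 4 by rewrite ge_min lexx orbT.
exists d; split; [by apply/andP; split; lra|exact: cvg_visit|].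
apply: limr_ge; first exact: cvg_visit.
exists N0.+1 => //= N /= N0N; have N_gt0 : 0 < N%:R :> R.
  by rewrite ltr0n (leq_trans _ N0N).
rewrite ler_pdivlMr //.
have : win R (fun n => ~~ visit d n) 0 N.+1 <=
       win R (fun n => near_int R e (y n - 0)) 0 N.+1.
  apply: le_win => n /frac_part_itvP nv; apply/asboolP.
  have /existsNP[m /negP] : ~ forall m : int, d <= `|y n - m%:~R| by move=> h; apply: nv.
  by rewrite -ltNge => h; exists m; rewrite subr0 (le_trans (ltW h)) // ge_min lexx.
have /H : (N0 <= N.+1)%N by rewrite (leq_trans (leqnSn _)) // leqW.
rewrite winC -[N.+1%:R]natr1; lra.
Qed.
End VisitFrequency.

(** * Salem numbers *)

(** Encodes the integers from [- K] to [K] by naturals up to [2 * K], so that [iota] can list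
    them. *)
Lemma absz_shift (r : int) (K : nat) : (`|r| <= K)%N ->
  (`|(r + K%:Z)%R| < (2 * K).+1)%N /\ (`|(r + K%:Z)%R|%N)%:Z - K%:Z = r.
Proof. by move=> rK; split; lia. Qed.

(** * The orbit as an integer trace minus a bounded conjugate sum *)

Section ConjugateSums.
Variables (R : realType) (alpha : R) (P : {poly int}) (rs : seq R[i]) (z1 : R[i]).
Local Notation alphaC := (real_complex R alpha).
Hypotheses (rs_uniq : uniq rs)
  (P_rs : map_poly intr P = \prod_(z <- rs) ('X - z%:P)) (P_monic : P \is monic)
  (rs_alpha : alphaC \in rs) (rs_z1 : z1 \in rs) (z1_alpha : z1 != alphaC)
  (cmod_z1 : cmod z1 = 1)
  (cmod_rs : forall z, z \in rs -> z != alphaC -> cmod z <= 1)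
  (z1_powers : forall z k, z \in rs -> z != z1 -> (0 < k)%N -> z1 ^+ k != z ^+ k)
  (z1_aperiodic : forall k, (0 < k)%N -> z1 ^+ k != 1).
Variables (d : nat) (l : 'I_d -> int) (L : nat) (y0 : R).
Let f (z : R[i]) := \sum_(i < d) (l i)%:~R * z ^+ i.
Hypotheses (L_gt0 : (0 < L)%N) (y0E : real_complex R (L%:R * y0) = f alphaC)
  (f_z1 : f z1 != 0).

Let y n := y0 * alpha ^+ n.
Let A := companion _ P rs.
(** The sum of [f z * z ^+ n] over all of [rs], written with matrix traces so that it is an integer
    whose residue mod [L] depends only on [A ^+ n] mod [L]. *)
Let x n : int := \sum_(i < d) l i * \tr (A ^+ (i + n)).
Let conj := rem alphaC rs.
Let E n := \sum_(z <- conj) f z * z ^+ n.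
Let B := \sum_(z <- conj) cmod (f z).

Let conjE z : (z \in conj) = (z != alphaC) && (z \in rs).
Proof. by rewrite mem_rem_uniq. Qed.

Let cmod_sum (I : Type) (s : seq I) (F : I -> R[i]) :
  cmod (\sum_(i <- s) F i) <= \sum_(i <- s) cmod (F i).
Proof.
elim: s => [|i s IH]; first by rewrite !big_nil /cmod ComplexField.Normc.normc0.
by rewrite !big_cons (le_trans (cmodD _ _ _)) // lerD2l.
Qed.

Let xE n : (x n)%:~R = \sum_(z <- rs) f z * z ^+ n.
Proof.
rewrite /x rmorph_sum /=.
under eq_bigr => i _ do
  rewrite rmorphM /= (mxtrace_companion_exp _ _ _ rs_uniq P_rs P_monic) mulr_sumr.
rewrite exchange_big /=; apply: eq_bigr => z _.
by rewrite /f mulr_suml; apply: eq_bigr => i _; rewrite exprD mulrA.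
Qed.

Let yE n : real_complex R (L%:R * y n) = (x n)%:~R - E n.
Proof.
rewrite xE (big_rem alphaC) //= -/conj -/(E n) addrK -y0E /y mulrA.
by rewrite rmorphM rmorphXn.
Qed.

Let cmod_E n : cmod (E n) <= B.
Proof.
apply: le_trans (cmod_sum _ _ _) _.
rewrite /B !big_seq; apply: ler_sum => z; rewrite conjE => /andP[za zs].
rewrite cmodM cmodX ler_piMr ?cmod_ge0 // exprn_ile1 ?cmod_ge0 //.
exact: cmod_rs.
Qed.

Let B_ge0 : 0 <= B.
Proof. by apply: sumr_ge0 => z _; exact: cmod_ge0. Qed.

Let L_ge1 : 1 <= L%:R :> R.
Proof. by rewrite ler1n. Qed.

(** If [y n] is near [t + m], then [E n] is near [r - L * t] for the integer [r = x n - L * m],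
    which is bounded because [E] is. For each such [r] the constant enters the exponential sum as a
    term of frequency 1, from which [z1_aperiodic] separates [z1]. *)
Lemma orbit_vanish t h : 0 < h ->
  exists2 e, 0 < e & exists N0, forall N, (N0 <= N)%N ->
    win R (fun n => near_int R e (y n - t)) 0 N <= h * N%:R.
Proof.
move=> h0.
have [K hK] : exists K : nat, B + L%:R * `|t| + L%:R <= K%:R.
  by eexists; apply/ltW; exact: truncnS_gt.
pose s (i : nat) := (real_complex R (L%:R * t - (i%:Z - K%:Z)%:~R), 1 : R[i]) ::
  [seq (f z, z) | z <- rem z1 conj].
pose g i n := cmod (f z1 * z1 ^+ n + \sum_(u <- s i) u.1 * u.2 ^+ n).
have conj_uniq : uniq conj by rewrite rem_uniq.
have conj_z1 : z1 \in conj by rewrite conjE z1_alpha.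
have sP i u : u \in s i -> u.2 = 1 \/ (u.2 != z1 /\ u.2 \in conj).
  rewrite inE => /orP[/eqP ->|/mapP[z zs ->]]; first by left.
  by right; move: zs; rewrite mem_rem_uniq // inE => /andP[].
have gE i n : g i n = cmod (E n + real_complex R (L%:R * t - (i%:Z - K%:Z)%:~R)).
  rewrite /g /s big_cons big_map /= expr1n mulr1 /E (big_rem z1 conj_z1) /=.
  by congr cmod; rewrite addrCA addrC.
have Hg i : sublevels_vanish R (g i).
  apply: sublevels_vanish_expsum => //.
  - move=> u /sP[->|[_]]; first by rewrite /cmod ComplexField.Normc.normc1.
    by rewrite conjE => /andP[? ?]; exact: cmod_rs.
  - move=> u k /sP[->|[uz]] k0; first by rewrite expr1n z1_aperiodic.
    by move: k0; rewrite conjE => /andP[_ us] k0; exact: z1_powers.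
have [e e0 [N0 H]] := sublevels_vanish_has _ _ (iota 0 (2 * K).+1) g _ Hg h0.
have L0 : 0 < L%:R :> R by rewrite ltr0n.
(* The 1 accounts for the last summand [L%:R] in the bound [K] on [r]; dividing by [L%:R]
   compensates the factor between [y] and [E]. *)
exists (Num.min 1 (e / L%:R)); first by rewrite lt_min ltr01 divr_gt0.
exists N0 => N /H; apply: le_trans; apply: le_win => n /asboolP[m ym].
have {ym} /andP[y1 ye] : (`|y n - t - m%:~R| <= 1) && (`|y n - t - m%:~R| <= e / L%:R).
  by rewrite -le_min.
pose r := x n - L%:Z * m.
have rE : E n + real_complex R (L%:R * t - r%:~R) =
          - real_complex R (L%:R * (y n - t - m%:~R)).
  have -> : E n = (x n)%:~R - real_complex R (L%:R * y n) by rewrite yE; ring.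
  have -> : (x n)%:~R = real_complex R (x n)%:~R by rewrite rmorph_int.
  have -> : r%:~R = (x n)%:~R - L%:R * m%:~R :> R by rewrite /r rmorphB /= intrM.
  by rewrite -rmorphB -rmorphD -rmorphN; congr (real_complex R _); ring.
have rK : `|r%:~R| <= K%:R :> R.
  have -> : `|r%:~R : R| = cmod (real_complex R (L%:R * t) + E n +
      real_complex R (L%:R * (y n - t - m%:~R))).
    rewrite -cmod_real; congr cmod.
    have -> : E n = - real_complex R (L%:R * (y n - t - m%:~R)) -
        real_complex R (L%:R * t - r%:~R) by rewrite -rE addrK.
    have key (a b c : R[i]) : c = a + (- b - (a - c)) + b by ring.
    by rewrite (rmorphB (real_complex R) (L%:R * t)) -key.
  apply: le_trans (cmodD _ _ _) _.
  apply: le_trans (lerD (cmodD _ _ _) (lexx _)) _.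
  rewrite !cmod_real !normrM (ger0_norm (ltW L0)).
  have := cmod_E n; have : L%:R * `|y n - t - m%:~R| <= L%:R * 1.
    by rewrite ler_pM2l.
  by move: hK; lra.
have rK' : (`|r| <= K)%N.
  by rewrite -(ler_nat R) natr_absz intr_norm.
have [rK1 rK2] := absz_shift r K rK'.
apply/hasP; exists `|(r + K%:Z)%R|%N; first by rewrite mem_iota leq0n add0n.
rewrite gE rK2.
rewrite rE cmodN cmod_real normrM (ger0_norm (ltW L0)).
by rewrite mulrC -ler_pdivlMr.
Qed.

(** A match of [a] and [a'] persists for all later times [k]: congruence mod [L] survives
    multiplication by [A ^+ k], and multiplication by [z ^+ k] does not expand distances. *)
Lemma orbit_recurs e : 0 < e ->
  exists b, forall a, exists2 a', (a' <= b)%N &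
    forall k, near_int R e (y (a + k)%N - y (a' + k)%N).
Proof.
move=> e0.
have B1 : 0 < B + 1 by exact: ltr_wpDl.
(* The weights [cmod (f z)] sum to [B], so the total error stays below [e]; adding 1 keeps the
   divisor positive. *)
pose e' := e / (B + 1); have e'0 : 0 < e' by rewrite divr_gt0.
have col z : z \in conj -> finitely_coloured (fun a b => cmod (z ^+ a - z ^+ b) <= e').
  rewrite conjE => /andP[za zs].
  apply: (finitely_coloured_complex R (fun n => z ^+ n) 1) => // n.
  by rewrite cmodX exprn_ile1 ?cmod_ge0 // cmod_rs.
have [b Hb] := finitely_coloured_recurs _ (finitely_coloured_and _ _
  (finitely_coloured_mx _ (fun n => A ^+ n) _ L_gt0) (finitely_coloured_all _ _ _ col)).
exists b => a; have [a' a'b [[D AD] Hz]] := Hb a; exists a' => // k.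
pose m := \sum_(i < d) l i * \tr (A ^+ (i + k) * D).
have xm : x (a + k)%N - x (a' + k)%N = L%:Z * m.
  rewrite /x /m -sumrB mulr_sumr; apply: eq_bigr => i _.
  rewrite -mulrBr mulrCA; congr (_ * _).
  rewrite -mxtraceZ.
  have -> : L%:Z *: (A ^+ (i + k) * D) = A ^+ (i + k) * (A ^+ a - A ^+ a').
    by rewrite AD; exact: scalemxAr.
  rewrite mulrBr -!exprD raddfB /=.
  by rewrite -!addnA ![(k + _)%N]addnC.
apply/asboolP; exists m.
have L0 : 0 < L%:R :> R by rewrite ltr0n.
have ymE : real_complex R (L%:R * (y (a + k)%N - y (a' + k)%N - m%:~R)) =
    - (E (a + k)%N - E (a' + k)%N).
  have EE n : E n = real_complex R (x n)%:~R - real_complex R (L%:R * y n).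
    by rewrite yE rmorph_int; ring.
  rewrite !EE -!rmorphB -rmorphN; congr (real_complex R _).
  have : (x (a + k)%N - x (a' + k)%N)%:~R = L%:R * m%:~R :> R by rewrite xm intrM.
  by rewrite rmorphB /= => ?; lra.
have : cmod (E (a + k)%N - E (a' + k)%N) <= B * e'.
  rewrite /E -sumrB; apply: le_trans (cmod_sum _ _ _) _.
  rewrite /B mulr_suml !big_seq; apply: ler_sum => z zc.
  rewrite -mulrBr cmodM ler_wpM2l ?cmod_ge0 //.
  rewrite !exprD -mulrBl cmodM cmodX -[leRHS]mulr1 ler_pM ?exprn_ge0 ?cmod_ge0 ?Hz //.
  move: zc; rewrite conjE => /andP[za zs].
  by rewrite exprn_ile1 ?cmod_ge0 // cmod_rs.
rewrite -cmodN -ymE cmod_real normrM (ger0_norm (ltW L0)) => H.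
have Be : B * e' <= e.
  by rewrite /e' mulrCA ler_piMr ?(ltW e0) // ler_pdivrMr // mul1r lerDl.
apply: le_trans Be; apply: le_trans H.
by rewrite ler_peMl.
Qed.
End ConjugateSums.

(** In characteristic 0 the derivative is nonzero of smaller degree, hence coprime to [p]. *)
Lemma irreducible_roots_uniq (F : numFieldType) (p : {poly rat}) (rs : seq F) :
  irreducible_poly p -> map_poly ratr p = \prod_(z <- rs) ('X - z%:P) -> uniq rs.
Proof.
move=> p_irr p_rs; rewrite -separable.separable_prod_XsubC -p_rs separable.separable_map.
rewrite separable.separable_poly.unlock irreducible_poly_coprime //.
have p1 : (1 < size p)%N by case: p_irr.
have p'0 : p^`() != 0 by rewrite -size_poly_gt0 polyorder.size_deriv ltn_predRL.
by rewrite gtNdvdp // lt_size_deriv // -size_poly_gt0 ltnW.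
Qed.

Lemma visit_freqE (R : realType) (a y d : R) :
  visit_freq a y d =
  fun N => win R (fun n => frac_part (y * a ^+ n) \in `[d, 1 - d]) 0 N.+1 / N%:R.
Proof.
apply/funext => N; rewrite /visit_freq /win cardsE -sum1_card big_mkcond natr_sum.
by congr (_ / _); apply: eq_bigr => i _; rewrite add0n unfold_in /=; case: ifP.
Qed.

Lemma visit_freqN (R : realType) (a y d : R) : 0 < d ->
  visit_freq a (- y) d = visit_freq a y d.
Proof.
move=> d0; rewrite !visit_freqE; apply/funext => N; congr (_ / _).
by apply: eq_win => n; rewrite mulNr frac_part_itvN.
Qed.

Lemma salem_visit (R : realType) (alpha : R) d (l : 'I_d -> int) (L : nat) (y0 : R) :
  salem_number alpha -> (0 < L)%N ->
  y0 = (\sum_(i < d) (l i)%:~R * alpha ^+ i) / L%:R -> y0 != 0 ->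
  exists e, [/\ 0 < e < 1 / 2, cvgn (visit_freq alpha y0 e)
              & 1 / 2 <= limn (visit_freq alpha y0 e)].
Proof.
move=> [alpha_int alpha1 alpha_conj [z1 [[p p_min p_z1] z1_alpha z1_1]]] L0 y0E y00.
have [P P_monic pE] := minpoly_int _ _ _ alpha_int p_min.
have [p_monic p_irr p_alpha] := p_min.
have [rs p_rs] := closed_field_poly_normal (map_poly (ratr : rat -> R[i]) p).
rewrite lead_coef_map (monicP p_monic) rmorph1 scale1r in p_rs.
have rs_uniq := irreducible_roots_uniq _ _ _ p_irr p_rs.
have map_intC (q : {poly int}) :
    map_poly (ratr : rat -> R[i]) (map_poly intr q) = map_poly intr q.
  by rewrite -map_poly_comp; apply: eq_map_poly => x /=; exact: rmorph_int.
have P_rs : map_poly intr P = \prod_(z <- rs) ('X - z%:P) by rewrite -p_rs pE map_intC.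
have rsE z : (z \in rs) = root (map_poly ratr p) z by rewrite p_rs root_prod_XsubC.
have rs_alpha : real_complex R alpha \in rs.
  rewrite rsE.
  have -> : map_poly (ratr : rat -> R[i]) p = map_poly (real_complex R) (map_poly ratr p).
    by rewrite -map_poly_comp; apply: eq_map_poly => x /=; rewrite fmorph_rat.
  by rewrite fmorph_root.
have rs_z1 : z1 \in rs by rewrite rsE.
have cmod_rs z : z \in rs -> z != real_complex R alpha -> cmod z <= 1.
  by rewrite rsE => zp; apply: alpha_conj; exists p.
have transfer (q : {poly rat}) : root (map_poly ratr q) z1 ->
    root (map_poly ratr q) (real_complex R alpha).
  move=> /(irreducible_dvdp_root _ _ _ _ _ _ p_irr p_z1) pq.
  by apply: root_dvdp (_ : root (map_poly ratr p) _); rewrite ?dvdp_map -?rsE.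
have alphaX k : (0 < k)%N -> 1 < cmod (real_complex R alpha ^+ k).
  move=> k0; rewrite cmodX cmod_real ger0_norm ?(ltW (lt_trans ltr01 alpha1)) //.
  by rewrite exprn_egt1 // -lt0n.
(* A collision at [z1] would transfer to [alpha]: some other conjugate [x], of modulus at most 1,
   would satisfy [x ^+ k = alpha ^+ k], which has modulus above 1. *)
have z1_powers z k : z \in rs -> z != z1 -> (0 < k)%N -> z1 ^+ k != z ^+ k.
  move=> zs zz1 k0; apply/negP => /eqP zk.
  have [||x [xs xa xk]] := conjugate_powers_collide _ p
    (map_poly intr (char_poly (companion _ P rs ^+ k))) rs k
    (real_complex R alpha) z1 z p_irr rs_uniq p_rs _ _ zz1 (esym zk).
  - by rewrite map_intC (char_poly_companion_exp _ _ _ rs_uniq P_rs P_monic).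
  - by split.
  have := alphaX k k0; rewrite -xk cmodX ltNge exprn_ile1 ?cmod_ge0 //.
  exact: cmod_rs.
have z1_aperiodic k : (0 < k)%N -> z1 ^+ k != 1.
  move=> k0; apply/negP => /eqP zk.
  have := transfer ('X^k - 1).
  rewrite rmorphB rmorph1 /= map_polyXn /root !hornerE zk subrr eqxx.
  move=> /(_ isT); rewrite subr_eq0 => /eqP ak; have := alphaX k k0.
  by rewrite ak /cmod ComplexField.Normc.normc1 ltxx.
pose f (z : R[i]) := \sum_(i < d) (l i)%:~R * z ^+ i.
have fE z : f z = (map_poly ratr (\sum_(i < d) (l i)%:~R *: 'X^i)).[z].
  rewrite rmorph_sum horner_sum; apply: eq_bigr => i _.
  by rewrite /= map_polyZ map_polyXn hornerZ hornerXn rmorph_int.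
have LR : L%:R != 0 :> R by rewrite pnatr_eq0 -lt0n.
have fa : real_complex R (L%:R * y0) = f (real_complex R alpha).
  rewrite y0E mulrC divfK // rmorph_sum; apply: eq_bigr => i _.
  by rewrite rmorphM rmorphXn rmorph_int.
(* [f] is a rational polynomial, so a zero at [z1] would transfer to [alpha], where its value is
   [L%:R * y0]. *)
have fz1 : f z1 != 0.
  apply: contra (mulf_neq0 LR y00) => fz.
  have : root (map_poly ratr (\sum_(i < d) (l i)%:~R *: 'X^i)) z1 by rewrite /root -fE.
  by move=> /transfer; rewrite /root -fE -fa fmorph_eq0.
have [e He] := visit_half _ (fun n => y0 * alpha ^+ n)
  (orbit_vanish R alpha P rs z1 rs_uniq P_rs P_monic rs_alpha rs_z1 z1_alpha
    z1_1 cmod_rs z1_powers z1_aperiodic d l L y0 L0 fa fz1)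
  (orbit_recurs R alpha P rs rs_uniq P_rs P_monic rs_alpha cmod_rs d l L y0 L0 fa).
by exists e; rewrite visit_freqE.
Qed.

Theorem theorem1p4 (R : realType) (alpha : R) (d : nat)
    (sigma0 : {rmorphism Qadjoin alpha -> R[i]}) :
  salem_number alpha -> has_degree alpha d ->
  sigma0 (Qgen alpha) = real_complex R alpha^-1 ->
  exists delta : nat -> R -> R -> R,
    forall (L : nat) (l : 'I_d -> int) (eta : Qadjoin alpha),
      (1 <= L)%N ->
      gcdn (\big[gcdn/0%N]_(i < d) `|l i|%N) L = 1%N ->
      eta = (\sum_(i < d) (l i)%:~R * Qgen alpha ^+ i) / L%:R ->
      eta != 0 ->
      let delta0 := delta L `|Qadjoin_val eta| (cmod (sigma0 eta)) in
      [/\ 0 < delta0 < 1 / 2,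
          cvgn (visit_freq alpha (Qadjoin_val eta) delta0)
        & 1 / 2 <= limn (visit_freq alpha (Qadjoin_val eta) delta0)].
Proof.
move=> salem _ _.
(* Quantifying over all [y] of absolute value [r] lets a choice from this set depend on [r]
   alone. *)
pose good (r : R) : set R := [set e | forall y : R, `|y| = r ->
  [/\ 0 < e < 1 / 2, cvgn (visit_freq alpha y e)
    & 1 / 2 <= limn (visit_freq alpha y e)]]%classic.
(* The absolute value determines [eta] up to sign, and the frequency of visits
   to the symmetric interval does not see the sign. *)
exists (fun _ r _ => xget 0 (good r)) => L l eta L0 _ etaE eta0.
have y0E : val eta = (\sum_(i < d) (l i)%:~R * alpha ^+ i) / L%:R.
  rewrite etaE rmorphM fmorphV rmorph_nat rmorph_sum; congr (_ / _).
  by apply: eq_bigr => i _; rewrite rmorphM rmorphXn rmorph_int.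
have y00 : val eta != 0 by rewrite fmorph_eq0.
have [e [e_itv e_cvg e_lim]] := salem_visit R alpha d l L (val eta) salem L0 y0E y00.
have e_good : good `|Qadjoin_val eta| e.
  have e0 : 0 < e by case/andP: e_itv.
  move=> y /eqP; rewrite eqr_norm2 => /orP[] /eqP -> //.
  by rewrite visit_freqN.
by have := @xgetPex _ 0 _ (ex_intro _ _ e_good); apply.
Qed.
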